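(* Let $\Delta$ be a (non-degenerate) isosceles triangle in the plane with vertices $A,B,C$ and $|AB|=|BC|$, scaled so that $|AC|=1$, and let $b>0$ be the distance from $B$ to the line $AC$. Let $\varphi(p)=|pA|\,|pB|\,|pC|$, and consider the local maxima and local minima of the restriction $\varphi|_{\partial\Delta}$ of $\varphi$ to the boundary of $\Delta$. Then: (i) if $b\ge \frac{1}{\sqrt 8}$, $\varphi|_{\partial\Delta}$ has precisely three local maxima and precisely three local minima: the minima are at the three vertices, and there is exactly one maximum in the interior of each side; (ii) if $b<\frac{1}{\sqrt 8}$, $\varphi|_{\partial\Delta}$ has precisely four local maxima and precisely four local minima: the minima are at the three vertices and one point in the interior of $AC$, and there are exactly two maxima in the interior of $AC$ and exactly one maximum in the interior of each of $AB$ and $BC$.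
   Context: $|pX|$ denotes the Euclidean distance from $p$ to $X$. $\partial\Delta$ is the union of the three closed sides of the triangle, with the topology induced from the plane. The interior of a side means the side without its two endpoints. *)

(* Defs.v *)
From HB Require Import structures.
From mathcomp Require Import all_boot all_order all_algebra.
From mathcomp Require Import all_classical all_reals all_analysis.
Set Implicit Arguments.
Unset Strict Implicit.
Unset Printing Implicit Defensive.
Import Order.TTheory GRing.Theory Num.Theory.
Import numFieldNormedType.Exports.
Local Open Scope classical_set_scope.
Local Open Scope ring_scope.

(* The plane is [R * R].  Its library topology is the product topology, i.e.
   the usual one, but its library norm is the sup norm, hence the separate
   Euclidean distance below. *)
Definition dist (R : realType) (p q : R * R) : R :=
  Num.sqrt ((p.1 - q.1) ^+ 2 + (p.2 - q.2) ^+ 2).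

Definition dist_to_set (R : realType) (p : R * R) (X : set (R * R)) : R :=
  inf [set dist p q | q in X].

Definition line (R : realType) (P Q : R * R) : set (R * R) :=
  [set p | exists t : R,
     p = ((1 - t) * P.1 + t * Q.1, (1 - t) * P.2 + t * Q.2)].

Definition side (R : realType) (P Q : R * R) : set (R * R) :=
  [set p | exists t : R, 0 <= t <= 1 /\
     p = ((1 - t) * P.1 + t * Q.1, (1 - t) * P.2 + t * Q.2)].

Definition side_interior (R : realType) (P Q : R * R) : set (R * R) :=
  side P Q `\` [set P; Q].

Definition collinear (R : realType) (A B C : R * R) : Prop :=
  exists P Q : R * R, P != Q /\ [set A; B; C] `<=` line P Q.

Definition triangle_boundary (R : realType) (A B C : R * R) : set (R * R) :=
  side A B `|` side B C `|` side A C.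

Definition phi (R : realType) (A B C p : R * R) : R :=
  dist p A * dist p B * dist p C.

(* Points of [D] at which the restriction of [f] to [D] has a (not necessarily
   strict) local maximum, resp. minimum, for the topology induced on [D]. *)
Definition local_maxima (R : realType) (T : topologicalType) (f : T -> R)
    (D : set T) : set T :=
  [set p | D p /\ \forall q \near within D (nbhs p), f q <= f p].

Definition local_minima (R : realType) (T : topologicalType) (f : T -> R)
    (D : set T) : set T :=
  [set p | D p /\ \forall q \near within D (nbhs p), f p <= f q].

(* Main.v *)
Require Import Defs.
From HB Require Import structures.
From mathcomp Require Import all_boot all_order all_algebra.
From mathcomp Require Import all_classical all_reals all_analysis.
From mathcomp Require polyrcf.
From mathcomp Require Import ring lra.
Import Order.TTheory GRing.Theory Num.Theory.
Import numFieldNormedType.Exports.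
Local Open Scope classical_set_scope.
Local Open Scope card_scope.
Local Open Scope ring_scope.

(** The boundary is treated one side at a time.  Near an interior point of a
    side the two other sides are absent, because they are closed, so the local
    extrema of phi there are those of the function t |-> phi (P + t (Q - P)) on
    ]0, 1[ ([local_maxima_on_side]).  The vertices are zeros of phi, which is
    positive elsewhere, so they are minima and not maxima ([boundary_extrema]).

    Stewart's theorem turns phi^2 on each side into a polynomial in t and in
    k = |AB|^2 = b^2 + 1/4, and the signs of its derivative give the intervals
    on which phi is monotone.

    On the leg AB, phi^2 = k^2 t^2 (1 - t)^2 (1 - t + k t^2), and its derivative
    has on ]0, 1[ the sign of (1 - t) (2 - 5 t) + 2 k t^2 (2 - 3 t).  This is
    positive at 2/5 and negative at 2/3, so it has a root s between them; as k
    enters linearly, it can be eliminated with the equation for s, and what is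
    left is s - t up to a positive factor.  Hence there is a single change of
    sign, and one maximum ([leg_factor_sign], [leg_extrema]).  Exchanging A and
    C gives the leg CB.

    On the base AC, phi^2 = t^2 (1 - t)^2 (k - t (1 - t)), with derivative
    t (1 - t) (1 - 2 t) (2 k - 3 t (1 - t)).  As t (1 - t) <= 1/4, the last
    factor changes sign exactly when k < 3/8, that is b < 1 / sqrt 8; the
    midpoint is then a minimum between two maxima ([base_extrema_low]), and
    otherwise the only maximum ([base_extrema_high]). *)

(** * Local extrema on an interval *)

Lemma local_minimaN (R : realType) (T : topologicalType) (f : T -> R)
  (D : set T) : local_minima f D = local_maxima (fun x => - f x) D.
Proof.
apply/funext=> p; congr (_ /\ within D (nbhs p) _).
by apply/funext=> q; rewrite lerN2.
Qed.

(** A path along which f exceeds its initial value excludes a maximum at the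
    initial point.  Sides serve as paths for the vertices of a triangle, and id
    and -id for the two directions on the line. *)
Lemma not_local_max_path (R : realType) (T : topologicalType) (f : T -> R)
    (D : set T) (gamma : R -> T) (t b : R) :
  t < b -> {for t, continuous gamma} ->
  (forall s, t < s < b -> D (gamma s) /\ f (gamma t) < f (gamma s)) ->
  ~ local_maxima f D (gamma t).
Proof.
move=> tb gc H [_]; rewrite near_withinE => /gc hmax.
have hr : \forall s \near t^'+, D (gamma s) -> f (gamma s) <= f (gamma t).
  exact: cvg_at_right_filter hmax.
have [s [[h ts] sb]] : exists s, (((D (gamma s) -> f (gamma s) <= f (gamma t))
    /\ t < s) /\ s < b).
  apply: (@filter_ex _ t^'+); apply: filterI; last exact: nbhs_right_lt.
  by apply: filterI => //; exact: nbhs_right_gt.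
have [|/h] := H s; first by rewrite ts.
by move=> /le_lt_trans/[apply]; rewrite ltxx.
Qed.

Lemma not_local_max_right (R : realType) (g : R -> R) (D : set R) (t b : R) :
  t < b -> (forall s, t < s < b -> D s /\ g t < g s) -> ~ local_maxima g D t.
Proof. by move=> tb; apply: (@not_local_max_path _ _ g D id). Qed.

Lemma not_local_max_left (R : realType) (g : R -> R) (D : set R) (a t : R) :
  a < t -> (forall s, a < s < t -> D s /\ g t < g s) -> ~ local_maxima g D t.
Proof.
move=> ta H; rewrite -[t]opprK.
apply: (@not_local_max_path _ _ g D -%R (- t) (- a)).
- by rewrite ltrN2.
- exact: opp_continuous.
- by move=> s st; rewrite opprK; apply: H; lra.
Qed.

Lemma local_max_sub (R : realType) (g : R -> R) (a b c d t : R) :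
  a <= c -> d <= b -> c < t < d ->
  local_maxima g `]a, b[ t <-> local_maxima g `]c, d[ t.
Proof.
move=> ac db ctd; have tcd : t \in `]c, d[ by rewrite in_itv.
split=> -[_]; rewrite near_withinE => h; split.
- by rewrite /= in_itv.
- rewrite near_withinE; near=> s => scd.
  have := near h s; apply=> //.
  by move: scd; rewrite /= !in_itv /=; lra.
- by rewrite /= in_itv /=; lra.
- rewrite near_withinE; near=> s => _.
  by have := near h s; apply=> //; near: s; exact: near_in_itvoo.
Unshelve. all: by end_near. Qed.

Lemma unimodal_extrema (R : realType) (g : R -> R) (a c b : R) :
  a < c < b ->
  {in `[a, c] &, {homo g : x y / x < y}} ->
  {in `[c, b] &, {homo g : x y /~ x < y}} ->
  local_maxima g `]a, b[ = [set c] /\ local_minima g `]a, b[ = set0.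
Proof.
move=> acb inc dec; split.
- apply/seteqP; split=> [t lt|_ ->].
  + have [] : `]a, b[%classic t by case: lt.
    rewrite /= in_itv /= => /andP[at_ tb].
    case: (ltgtP t c) => // [tc|ct].
    * case: (not_local_max_right R g `]a, b[ t c tc) => // s st.
      by split; rewrite ?/= ?in_itv /=;
        [lra | apply: inc; rewrite ?in_itv /=; lra].
    * case: (not_local_max_left R g `]a, b[ c t ct) => // s st.
      by split; rewrite ?/= ?in_itv /=;
        [lra | apply: dec; rewrite ?in_itv /=; lra].
  + split; first by rewrite /= in_itv.
    rewrite near_withinE; near=> s => /=; rewrite in_itv /= => asb.
    case: (ltgtP s c) => [sc|cs|->//]; apply: ltW.
    * by apply: inc; rewrite ?in_itv /=; lra.
    * by apply: dec; rewrite ?in_itv /=; lra.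
- rewrite local_minimaN; apply/seteqP; split=> // t lt.
  have : `]a, b[%classic t by case: lt.
  rewrite /= in_itv /= => /andP[at_ tb].
  case: (ltP t c) => [tc|ct].
  + case: (not_local_max_left R (fun x => - g x) `]a, b[ a t at_) => // s st.
    by split; rewrite ?/= ?in_itv /= ?ltrN2;
      [lra | apply: inc; rewrite ?in_itv /=; lra].
  + case: (not_local_max_right R (fun x => - g x) `]a, b[ t b tb) => // s st.
    by split; rewrite ?/= ?in_itv /= ?ltrN2;
      [lra | apply: dec; rewrite ?in_itv /=; lra].
Unshelve. all: by end_near. Qed.

(** Each point of ]a, b[ lies in ]a, m[, ]m, b[ or ]c, d[, and on each of these
    the function or its opposite is unimodal. *)
Lemma bimodal_extrema (R : realType) (g : R -> R) (a c m d b : R) :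
  a < c < m -> m < d < b ->
  {in `[a, c] &, {homo g : x y / x < y}} ->
  {in `[c, m] &, {homo g : x y /~ x < y}} ->
  {in `[m, d] &, {homo g : x y / x < y}} ->
  {in `[d, b] &, {homo g : x y /~ x < y}} ->
  local_maxima g `]a, b[ = [set c; d] /\ local_minima g `]a, b[ = [set m].
Proof.
move=> acm mdb inc1 dec1 inc2 dec2.
have [max1 min1] := unimodal_extrema _ _ _ _ _ acm inc1 dec1.
have [max2 min2] := unimodal_extrema _ _ _ _ _ mdb inc2 dec2.
(* Between the two peaks, the opposite function is unimodal with peak m. *)
have cmd : c < m < d by lra.
have [min3 max3] : local_minima g `]c, d[ = [set m] /\
    local_maxima g `]c, d[ = set0.
  rewrite local_minimaN.
  have -> : local_maxima g `]c, d[ = local_minima (fun x => - g x) `]c, d[.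
    rewrite local_minimaN; congr local_maxima.
    by apply/funext=> x; rewrite opprK.
  by apply: unimodal_extrema => // x y xI yI xy; rewrite ltrN2;
    [apply: dec1 | apply: inc2].
have sub (h : R -> R) t : a < t < b ->
    [/\ t < m -> (local_maxima h `]a, b[ t <-> local_maxima h `]a, m[ t),
        m < t -> (local_maxima h `]a, b[ t <-> local_maxima h `]m, b[ t) &
        c < t < d -> (local_maxima h `]a, b[ t <-> local_maxima h `]c, d[ t)].
  by move=> atb; split=> ?; apply: local_max_sub; lra.
have inab (h : R -> R) t : local_maxima h `]a, b[ t -> a < t < b.
  by case; rewrite /= in_itv.
rewrite !local_minimaN in min1 min2 min3 *.
split; apply/seteqP; split=> t.
- move=> ht; have [s1 s2 s3] := sub g t (inab _ _ ht).
  case: (ltgtP t m) => [tm|mt|tm].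
  + by left; move: ht => /(s1 tm); rewrite max1.
  + by right; move: ht => /(s2 mt); rewrite max2.
  + by move: ht; rewrite tm in s3 * => /(s3 cmd); rewrite max3.
- case=> ->.
  + have [|s1 _ _] := sub g c; first lra.
    by apply/s1; [lra | rewrite max1].
  + have [|_ s2 _] := sub g d; first lra.
    by apply/s2; [lra | rewrite max2].
- move=> ht; have [s1 s2 s3] := sub (fun x => - g x) t (inab _ _ ht).
  case: (ltgtP t m) => [tm|mt|//].
  + by move: ht => /(s1 tm); rewrite min1.
  + by move: ht => /(s2 mt); rewrite min2.
- move=> ->; have [|_ _ s3] := sub (fun x => - g x) m; first lra.
  by apply/(s3 cmd); rewrite min3.
Qed.

(** The mean value theorem for the polynomial that represents the square of g
    avoids differentiating square roots. *)
Lemma incr_of_sqr (R : realType) (g : R -> R) (p : {poly R}) (a b : R) :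
  {in `[a, b], forall t, 0 <= g t /\ g t ^+ 2 = p.[t]} ->
  {in `]a, b[, forall t, 0 < p^`().[t]} ->
  {in `[a, b] &, {homo g : x y / x < y}}.
Proof.
move=> gp dp x y xI yI xy; have [[gx0 gx] [gy0 gy]] := (gp _ xI, gp _ yI).
rewrite -(ltr_pXn2r (n := 2)) // gx gy -subr_gt0.
have [z zI ->] := polyrcf.mvt p xy.
rewrite mulr_gt0 ?subr_gt0 // dp //.
by move: xI yI zI; rewrite !in_itv /=; lra.
Qed.

Lemma decr_of_sqr (R : realType) (g : R -> R) (p : {poly R}) (a b : R) :
  {in `[a, b], forall t, 0 <= g t /\ g t ^+ 2 = p.[t]} ->
  {in `]a, b[, forall t, p^`().[t] < 0} ->
  {in `[a, b] &, {homo g : x y /~ x < y}}.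
Proof.
move=> gp dp y x yI xI xy; have [[gx0 gx] [gy0 gy]] := (gp _ xI, gp _ yI).
rewrite -(ltr_pXn2r (n := 2)) // gx gy -subr_lt0.
have [z zI ->] := polyrcf.mvt p xy.
rewrite nmulr_rlt0 ?subr_gt0 // dp //.
by move: xI yI zI; rewrite !in_itv /=; lra.
Qed.

(** * Points on the sides of a triangle *)

Definition point_on (R : realType) (P Q : R * R) (t : R) : R * R :=
  ((1 - t) * P.1 + t * Q.1, (1 - t) * P.2 + t * Q.2).
Arguments point_on {R}.

(** Twice the signed area of the triangle PQS. *)
Definition orient (R : realType) (P Q S : R * R) : R :=
  (Q.1 - P.1) * (S.2 - P.2) - (Q.2 - P.2) * (S.1 - P.1).
Arguments orient {R}.

Lemma point_on0 (R : realType) (P Q : R * R) : point_on P Q 0 = P.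
Proof. by case: P => x y; congr pair => /=; ring. Qed.

Lemma point_on1 (R : realType) (P Q : R * R) : point_on P Q 1 = Q.
Proof. by case: Q => x y; congr pair => /=; ring. Qed.

Lemma point_onC (R : realType) (P Q : R * R) (t : R) :
  point_on Q P t = point_on P Q (1 - t).
Proof. by congr pair => /=; ring. Qed.

Lemma point_on_continuous (R : realType) (P Q : R * R) :
  continuous (point_on P Q).
Proof.
move=> t; have affine (x y : R) :
    (1 - s) * x + s * y @[s --> t] --> (1 - t) * x + t * y.
  by apply: cvgD; apply: cvgM;
    do ?[exact: cvg_cst | exact: cvg_id | apply: cvgB].
exact: (cvg_pair (affine _ _) (affine _ _)).
Qed.

Lemma sideE (R : realType) (P Q : R * R) :
  side P Q = point_on P Q @` `[0, 1].
Proof.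
by apply/seteqP; split=> p [t]; [case=> tI ->|rewrite /= in_itv => tI <-];
  exists t.
Qed.

Lemma sideC (R : realType) (P Q : R * R) : side P Q = side Q P.
Proof.
suff H : forall X Y : R * R, side X Y `<=` side Y X.
  by apply/seteqP; split; exact: H.
move=> X Y; rewrite !sideE => p [t]; rewrite /= in_itv /= => tI <-{p}.
by exists (1 - t); rewrite -?point_onC //= in_itv /=; lra.
Qed.

Lemma side_closed (R : realType) (P Q : R * R) : closed (side P Q).
Proof.
rewrite sideE; apply: compact_closed; first exact: norm_hausdorff.
apply: continuous_compact; last exact: segment_compact.
exact/continuous_subspaceT/point_on_continuous.
Qed.

Lemma dist_ge0 (R : realType) (P Q : R * R) : 0 <= dist P Q.
Proof. exact: sqrtr_ge0. Qed.

Lemma dist_sqr (R : realType) (P Q : R * R) :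
  dist P Q ^+ 2 = (P.1 - Q.1) ^+ 2 + (P.2 - Q.2) ^+ 2.
Proof. by rewrite sqr_sqrtr // addr_ge0 // sqr_ge0. Qed.

Lemma distC (R : realType) (P Q : R * R) : dist P Q = dist Q P.
Proof. by congr Num.sqrt; ring. Qed.

Lemma distpp (R : realType) (P : R * R) : dist P P = 0.
Proof. by rewrite /dist !subrr expr0n /= addr0 sqrtr0. Qed.

(** Stewart's theorem for the cevian from S to the side PQ. *)
Lemma stewart (R : realType) (P Q S : R * R) (t : R) :
  dist (point_on P Q t) S ^+ 2 =
  (1 - t) * dist P S ^+ 2 + t * dist Q S ^+ 2 - t * (1 - t) * dist P Q ^+ 2.
Proof. by rewrite !dist_sqr /=; ring. Qed.

(** Heron's formula, for four times the squared area. *)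
Lemma orient_sqr (R : realType) (P Q S : R * R) :
  orient P Q S ^+ 2 = dist P Q ^+ 2 * dist P S ^+ 2 -
    ((dist P Q ^+ 2 + dist P S ^+ 2 - dist Q S ^+ 2) / 2) ^+ 2.
Proof. by rewrite !dist_sqr /orient; field. Qed.

Lemma orient_neq (R : realType) (P Q S : R * R) :
  orient P Q S != 0 -> P != Q.
Proof. by apply: contraNneq => ->; rewrite /orient; apply/eqP; ring. Qed.

Lemma point_on_inj (R : realType) (P Q : R * R) :
  P != Q -> injective (point_on P Q).
Proof.
move=> PQ t s [h1 h2]; apply/eqP; rewrite -subr_eq0.
have e1 : (t - s) * (Q.1 - P.1) = 0 by lra.
have e2 : (t - s) * (Q.2 - P.2) = 0 by lra.
apply: contraNT PQ => ts.
move/eqP: e1; move/eqP: e2; rewrite !mulf_eq0 (negPf ts) /= !subr_eq0.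
by case: P Q h1 h2 => [? ?] [? ?] _ _ /= /eqP-> /eqP->.
Qed.

Lemma side_interiorE (R : realType) (P Q : R * R) : P != Q ->
  side_interior P Q = point_on P Q @` `]0, 1[.
Proof.
move=> /point_on_inj inj; rewrite /side_interior sideE; apply/seteqP; split=> p.
- case=> -[t]; rewrite /= in_itv /= => /andP[t0 t1] <- /not_orP[nP nQ].
  exists t => //=; rewrite in_itv /= !lt_neqAle t0 t1 !andbT.
  apply/andP; split; apply/eqP => e; [apply: nP | apply: nQ].
  + by rewrite -e point_on0.
  + by rewrite e point_on1.
- case=> t; rewrite /= in_itv /= => tI <-; split.
  + by exists t => //=; rewrite in_itv /=; lra.
  + by case; [rewrite -[X in _ = X](@point_on0 _ P Q) |
      rewrite -[X in _ = X](@point_on1 _ P Q)] => /inj; lra.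
Qed.

Lemma side_interiorC (R : realType) (P Q : R * R) :
  side_interior P Q = side_interior Q P.
Proof. by rewrite /side_interior sideC setUC. Qed.

(** A point of one side lying on a second side would be aligned with the
    vertices of that second side, which the orientation rules out. *)
Lemma side_interior_disjoint (R : realType) (P Q S : R * R) (t : R) :
  orient P Q S != 0 -> 0 < t < 1 ->
  ~ side P S (point_on P Q t) /\ ~ side Q S (point_on P Q t).
Proof.
move=> oPQS t01; split=> -[s [_ [h1 h2]]].
- have : orient P S (point_on P Q t) = 0.
    by rewrite /orient /= h1 h2; ring.
  have -> : orient P S (point_on P Q t) = - t * orient P Q S.
    by rewrite /orient /=; ring.
  by move/eqP; rewrite mulf_eq0 (negPf oPQS) orbF oppr_eq0; lra.
- have : orient Q S (point_on P Q t) = 0.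
    by rewrite /orient /= h1 h2; ring.
  have -> : orient Q S (point_on P Q t) = (1 - t) * orient P Q S.
    by rewrite /orient /=; ring.
  by move/eqP; rewrite mulf_eq0 (negPf oPQS) orbF; lra.
Qed.

(** The parameter of the orthogonal projection to the line PQ. *)
Definition proj_param (R : realType) (P Q q : R * R) : R :=
  ((q.1 - P.1) * (Q.1 - P.1) + (q.2 - P.2) * (Q.2 - P.2)) / dist P Q ^+ 2.
Arguments proj_param {R}.

Lemma dist_gt0 (R : realType) (P Q : R * R) : P != Q -> 0 < dist P Q.
Proof.
move=> PQ; rewrite sqrtr_gt0 lt_neqAle addr_ge0 ?sqr_ge0 // andbT eq_sym.
rewrite paddr_eq0 ?sqr_ge0 // !sqrf_eq0 !subr_eq0.
by apply: contraNN PQ; case: P Q => [? ?] [? ?] /= /andP[/eqP-> /eqP->].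
Qed.

Lemma proj_paramK (R : realType) (P Q : R * R) : P != Q ->
  cancel (point_on P Q) (proj_param P Q).
Proof.
move=> /dist_gt0 d0 t; apply: (mulIf (lt0r_neq0 (exprn_gt0 2 d0))).
rewrite /proj_param divfK ?lt0r_neq0 ?exprn_gt0 //.
by rewrite dist_sqr /=; ring.
Qed.

Lemma proj_param_continuous (R : realType) (P Q : R * R) :
  continuous (proj_param P Q).
Proof.
move=> q; apply: cvgM; last exact: cvg_cst.
by apply: cvgD; apply: cvgM; do ?[exact: cvg_cst | apply: cvgB];
  [exact: cvg_fst | exact: cvg_snd].
Qed.

(** Near an interior point of a side the boundary consists of that side alone,
    the two other sides being closed; and the side is parametrized by the
    projection to it, which is continuous. *)
Lemma local_maxima_on_side (R : realType) (P Q S : R * R) (f : R * R -> R) :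
  orient P Q S != 0 ->
  local_maxima f (triangle_boundary P Q S) `&` side_interior P Q =
  point_on P Q @` local_maxima (f \o point_on P Q) `]0, 1[.
Proof.
move=> oPQS; have PQ := orient_neq _ _ _ _ oPQS.
have onb (t : R) : 0 < t < 1 -> triangle_boundary P Q S (point_on P Q t).
  by move=> t01; left; left; exists t; split=> //; lra.
rewrite side_interiorE //; apply/seteqP; split=> p.
- case=> -[_ pmax] [t /= t01 tp]; exists t => //; split=> //.
  move: pmax; rewrite -tp !near_withinE => /(point_on_continuous R P Q t) h.
  have {}h : \forall s \near t, triangle_boundary P Q S (point_on P Q s) ->
    f (point_on P Q s) <= f (point_on P Q t) by exact: h.
  near=> s; rewrite /= in_itv /= => s01.
  by have := near h s; apply=> //; exact: onb.
- case=> t [] /=; rewrite in_itv near_withinE /= => t01 tmax <-.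
  split; last by exists t; rewrite //= in_itv.
  split; first exact: onb.
  have [nPS nQS] := side_interior_disjoint R P Q S t oPQS t01.
  have nearC (X Y : R * R) : ~ side X Y (point_on P Q t) ->
      \forall q \near point_on P Q t, ~ side X Y q.
    move=> nXY; apply: open_nbhs_nbhs; split=> //.
    exact/closed_openC/side_closed.
  have cproj : proj_param P Q q @[q --> point_on P Q t] --> t.
    by rewrite -{2}(proj_paramK R P Q PQ t); exact: proj_param_continuous.
  have qmax : \forall q \near point_on P Q t,
      proj_param P Q q \in `]0, 1[ ->
      f (point_on P Q (proj_param P Q q)) <= f (point_on P Q t).
    exact: cproj tmax.
  have q01 : \forall q \near point_on P Q t, proj_param P Q q \in `]0, 1[.
    have /near_in_itvoo/cproj : t \in `]0, 1[ by rewrite in_itv.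
    by [].
  rewrite near_withinE; near=> q => -[[qPQ|qQS]|qPS].
  + move: qPQ; rewrite sideE => -[s _ sq].
    have es : proj_param P Q q = s by rewrite -sq proj_paramK.
    have := near qmax q; rewrite /= es sq; apply=> //.
    by rewrite -es; near: q.
  + by exfalso; move: qQS; near: q; exact: nearC.
  + by exfalso; move: qPS; near: q; exact: nearC.
Unshelve. all: by end_near. Qed.

Lemma triangle_boundary_rev (R : realType) (A B C : R * R) :
  triangle_boundary C B A = triangle_boundary A B C.
Proof.
by rewrite /triangle_boundary (sideC _ C B) (sideC _ B A) (sideC _ C A)
  (setUC (side B C)).
Qed.

Lemma triangle_boundary_swap (R : realType) (A B C : R * R) :
  triangle_boundary A C B = triangle_boundary A B C.
Proof.
by rewrite /triangle_boundary (sideC _ C B) setUC setUA setUAC.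
Qed.

(** * The product of distances along the sides of an isosceles triangle *)

Lemma phi_ge0 (R : realType) (A B C p : R * R) : 0 <= phi A B C p.
Proof. by rewrite !mulr_ge0 // dist_ge0. Qed.

Lemma phi_sqr (R : realType) (A B C p : R * R) :
  phi A B C p ^+ 2 = dist p A ^+ 2 * dist p B ^+ 2 * dist p C ^+ 2.
Proof. by rewrite !exprMn. Qed.

(** The values of phi^2 along the leg AB and along the base AC, parametrized
    from A, when |AB|^2 = |BC|^2 = k and |AC| = 1. *)
Definition leg_poly (R : realType) (k : R) : {poly R} :=
  (k ^+ 2)%:P * 'X^2 * (1 - 'X) ^+ 2 * (1 - 'X + k%:P * 'X^2).
Arguments leg_poly {R}.

Definition base_poly (R : realType) (k : R) : {poly R} :=
  'X^2 * (1 - 'X) ^+ 2 * (k%:P - 'X * (1 - 'X)).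
Arguments base_poly {R}.

(** The factor of the derivative of leg_poly that changes sign on ]0, 1[. *)
Definition leg_factor (R : realType) (k t : R) : R :=
  (1 - t) * (2 - 5 * t) + 2 * k * t ^+ 2 * (2 - 3 * t).
Arguments leg_factor {R}.

Lemma phi_legE (R : realType) (A B C : R * R) (k t : R) :
  dist A B ^+ 2 = k -> dist B C ^+ 2 = k -> dist A C ^+ 2 = 1 ->
  phi A B C (point_on A B t) ^+ 2 = (leg_poly k).[t].
Proof.
move=> dAB dBC dAC; rewrite phi_sqr !stewart !distpp (distC _ B A) dAB dBC dAC.
by rewrite /leg_poly !hornerE /=; ring.
Qed.

Lemma phi_baseE (R : realType) (A B C : R * R) (k t : R) :
  dist A B ^+ 2 = k -> dist B C ^+ 2 = k -> dist A C ^+ 2 = 1 ->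
  phi A B C (point_on A C t) ^+ 2 = (base_poly k).[t].
Proof.
move=> dAB dBC dAC.
rewrite phi_sqr !stewart !distpp (distC _ C A) (distC _ C B) dAB dBC dAC.
by rewrite /base_poly !hornerE /=; ring.
Qed.

Lemma deriv_leg_poly (R : realType) (k t : R) :
  (leg_poly k)^`().[t] = k ^+ 2 * t * (1 - t) * leg_factor k t.
Proof. by rewrite /leg_poly /leg_factor !poly.derivE !hornerE /=; ring. Qed.

Lemma deriv_base_poly (R : realType) (k t : R) :
  (base_poly k)^`().[t] = t * (1 - t) * (1 - 2 * t) * (2 * k - 3 * t * (1 - t)).
Proof. by rewrite /base_poly !poly.derivE !hornerE /=; ring. Qed.

Lemma leg_factor_root (R : realType) (k : R) : 0 < k ->
  exists2 s, 2 / 5 < s < 2 / 3 & leg_factor k s = 0.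
Proof.
move=> k0.
pose h : {poly R} := (1 - 'X) * (2%:P - 5%:P * 'X)
  + (2 * k)%:P * 'X^2 * (2%:P - 3%:P * 'X).
have hE t : h.[t] = leg_factor k t by rewrite /h /leg_factor !hornerE /=; ring.
have h0 : h.[2 / 5] = 32 / 125 * k by rewrite hE /leg_factor; field.
have h1 : h.[2 / 3] = - (4 / 9) by rewrite hE /leg_factor; field.
have [||s sI /eqP] := @polyrcf.poly_ivtoo _ h (2 / 5) (2 / 3).
- lra.
- by rewrite h0 h1; nra.
- by rewrite hE => hs; exists s => //; move: sI; rewrite in_itv.
Qed.

(** Eliminating k, which enters linearly, between leg_factor at t and at its
    root s leaves (s - t) times a factor that is positive on ]0, 1[. *)
Lemma leg_factor_sign (R : realType) (k s t : R) :
  2 / 5 < s < 2 / 3 -> leg_factor k s = 0 -> 0 < t < 1 ->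
  (t < s -> 0 < leg_factor k t) /\ (s < t -> leg_factor k t < 0).
Proof.
move=> /andP[s1 s2] hs /andP[t0 t1].
pose G := (5 * s - 2) * t ^+ 2
  + (1 - t) * (2 - 3 * s) * (2 * s * (1 - t) + t * (2 - 3 * s)).
have key : leg_factor k t * (s ^+ 2 * (2 - 3 * s)) = (s - t) * G.
  have -> : leg_factor k t * (s ^+ 2 * (2 - 3 * s)) =
    (s - t) * G + leg_factor k s * (t ^+ 2 * (2 - 3 * t)).
    by rewrite /G /leg_factor; ring.
  by rewrite hs mul0r addr0.
have c0 : 0 < s ^+ 2 * (2 - 3 * s) by rewrite mulr_gt0 ?exprn_gt0 //; lra.
have G0 : 0 < G.
  have [u v w z] : [/\ 0 < 1 - t, 0 < 2 - 3 * s, 0 < 5 * s - 2 & 0 < s].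
    by split; lra.
  apply: addr_gt0; first by rewrite mulr_gt0 ?exprn_gt0.
  apply: mulr_gt0; first exact: mulr_gt0.
  by apply: addr_gt0; apply: mulr_gt0 => //; apply: mulr_gt0.
split=> st.
- by rewrite -(pmulr_lgt0 _ c0) key pmulr_lgt0 // subr_gt0.
- by rewrite -(pmulr_llt0 _ c0) key pmulr_llt0 // subr_lt0.
Qed.

Lemma leg_extrema (R : realType) (A B C : R * R) (k : R) :
  dist A B ^+ 2 = k -> dist B C ^+ 2 = k -> dist A C ^+ 2 = 1 -> 0 < k ->
  exists s, [/\ 0 < s < 1,
    local_maxima (phi A B C \o point_on A B) `]0, 1[ = [set s] &
    local_minima (phi A B C \o point_on A B) `]0, 1[ = set0].
Proof.
move=> dAB dBC dAC k0; have [s s25 hs] := leg_factor_root R k k0.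
have s01 : 0 < s < 1 by lra.
have sq (a b : R) : {in `[a, b], forall t : R,
    0 <= (phi A B C \o point_on A B) t /\
    (phi A B C \o point_on A B) t ^+ 2 = (leg_poly k).[t]}.
  by move=> t _; split; [exact: phi_ge0 | exact: phi_legE].
have pos (t : R) : 0 < t < 1 -> 0 < k ^+ 2 * t * (1 - t).
  by move=> t01; rewrite !mulr_gt0 ?exprn_gt0 //; lra.
exists s; suff [-> ->] :
    local_maxima (phi A B C \o point_on A B) `]0, 1[ = [set s] /\
    local_minima (phi A B C \o point_on A B) `]0, 1[ = set0 by [].
apply: unimodal_extrema => //.
- apply: (incr_of_sqr _ _ _ _ _ (sq _ _)) => t; rewrite in_itv /= => ts.
  rewrite deriv_leg_poly mulr_gt0 ?pos //; first lra.
  by apply (leg_factor_sign R k s t s25 hs); lra.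
- apply: (decr_of_sqr _ _ _ _ _ (sq _ _)) => t; rewrite in_itv /= => ts.
  rewrite deriv_leg_poly pmulr_rlt0 ?pos //; last lra.
  by apply (leg_factor_sign R k s t s25 hs); lra.
Qed.

(** Since t (1 - t) < 1/4 away from the midpoint, the last factor of the
    derivative is positive there, and the sign is that of 1 - 2 t. *)
Lemma base_extrema_high (R : realType) (A B C : R * R) (k : R) :
  dist A B ^+ 2 = k -> dist B C ^+ 2 = k -> dist A C ^+ 2 = 1 -> 3 / 8 <= k ->
  local_maxima (phi A B C \o point_on A C) `]0, 1[ = [set 2^-1] /\
  local_minima (phi A B C \o point_on A C) `]0, 1[ = set0.
Proof.
move=> dAB dBC dAC k38.
have sq (a b : R) : {in `[a, b], forall t : R,
    0 <= (phi A B C \o point_on A C) t /\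
    (phi A B C \o point_on A C) t ^+ 2 = (base_poly k).[t]}.
  by move=> t _; split; [exact: phi_ge0 | exact: phi_baseE].
apply: unimodal_extrema; first lra.
- apply: (incr_of_sqr _ _ _ _ _ (sq _ _)) => t; rewrite in_itv /= => ts.
  by rewrite deriv_base_poly !mulr_gt0 //; nra.
- apply: (decr_of_sqr _ _ _ _ _ (sq _ _)) => t; rewrite in_itv /= => ts.
  by rewrite deriv_base_poly pmulr_llt0 ?nmulr_llt0 //; nra.
Qed.

(** The last factor of the derivative vanishes where t (1 - t) = 2 k / 3, that
    is at distance r from the midpoint. *)
Lemma base_extrema_low (R : realType) (A B C : R * R) (k : R) :
  dist A B ^+ 2 = k -> dist B C ^+ 2 = k -> dist A C ^+ 2 = 1 ->
  0 < k < 3 / 8 ->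
  exists r, [/\ 0 < r < 2^-1,
    local_maxima (phi A B C \o point_on A C) `]0, 1[
      = [set 2^-1 - r; 2^-1 + r] &
    local_minima (phi A B C \o point_on A C) `]0, 1[ = [set 2^-1]].
Proof.
move=> dAB dBC dAC k38.
have sq (a b : R) : {in `[a, b], forall t : R,
    0 <= (phi A B C \o point_on A C) t /\
    (phi A B C \o point_on A C) t ^+ 2 = (base_poly k).[t]}.
  by move=> t _; split; [exact: phi_ge0 | exact: phi_baseE].
pose r : R := Num.sqrt (4^-1 - 2 * k / 3).
have r2 : r ^+ 2 = 4^-1 - 2 * k / 3 by rewrite sqr_sqrtr //; lra.
have r0 : 0 < r by rewrite sqrtr_gt0; lra.
have r12 : r < 2^-1 by rewrite -(ltr_pXn2r (n := 2)) ?nnegrE //; lra.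
have fE t : (base_poly k)^`().[t] =
    6 * (t * (1 - t) * (2^-1 - t) * ((2^-1 - t - r) * (2^-1 - t + r))).
  have -> : (2^-1 - t - r) * (2^-1 - t + r) = (2^-1 - t) ^+ 2 - r ^+ 2 by ring.
  by rewrite deriv_base_poly r2; field.
exists r; suff [-> ->] : local_maxima (phi A B C \o point_on A C) `]0, 1[
      = [set 2^-1 - r; 2^-1 + r] /\
    local_minima (phi A B C \o point_on A C) `]0, 1[ = [set 2^-1].
  by split=> //; lra.
have pos (t : R) : 0 < t < 1 -> 0 < t * (1 - t).
  by move=> ?; rewrite mulr_gt0 //; lra.
apply: bimodal_extrema; try lra.
- apply: (incr_of_sqr _ _ _ _ _ (sq _ _)) => t; rewrite in_itv /= => ts.
  by rewrite fE !mulr_gt0 //; lra.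
- apply: (decr_of_sqr _ _ _ _ _ (sq _ _)) => t; rewrite in_itv /= => ts.
  rewrite fE pmulr_rlt0 // pmulr_rlt0; last by rewrite !mulr_gt0 //; lra.
  by rewrite nmulr_rlt0; lra.
- apply: (incr_of_sqr _ _ _ _ _ (sq _ _)) => t; rewrite in_itv /= => ts.
  rewrite fE pmulr_rgt0 // nmulr_rgt0; first by rewrite pmulr_llt0; lra.
  by rewrite pmulr_rlt0 ?pos; lra.
- apply: (decr_of_sqr _ _ _ _ _ (sq _ _)) => t; rewrite in_itv /= => ts.
  rewrite fE pmulr_rlt0 // nmulr_rlt0; first by rewrite nmulr_lgt0; lra.
  by rewrite pmulr_rlt0 ?pos; lra.
Qed.

(** * Assembling the boundary *)

Lemma phi_rev (R : realType) (A B C : R * R) : phi C B A = phi A B C.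
Proof. by apply/funext => p; rewrite /phi; ring. Qed.

Lemma side_left (R : realType) (P Q : R * R) : side P Q P.
Proof. by rewrite sideE; exists 0; rewrite ?point_on0 //= in_itv /=; lra. Qed.

Lemma side_right (R : realType) (P Q : R * R) : side P Q Q.
Proof. by rewrite sideC; exact: side_left. Qed.

Lemma local_minima_on_side (R : realType) (P Q S : R * R) (f : R * R -> R) :
  orient P Q S != 0 ->
  local_minima f (triangle_boundary P Q S) `&` side_interior P Q =
  point_on P Q @` local_minima (f \o point_on P Q) `]0, 1[.
Proof. by move=> o; rewrite !local_minimaN local_maxima_on_side. Qed.

Lemma phi_gt0_on_side (R : realType) (A B C : R * R) (t : R) :
  orient A B C != 0 -> 0 < t < 1 -> 0 < phi A B C (point_on A B t).
Proof.
move=> o /(side_interior_disjoint _ _ _ _ _ o)[nAC nBC].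
rewrite !mulr_gt0 // dist_gt0 //.
- by apply: contra_notN nAC => /eqP ->; exact: side_left.
- by apply: contra_notN nBC => /eqP ->; exact: side_left.
- by apply: contra_notN nAC => /eqP ->; exact: side_right.
Qed.

Lemma endpoints_not_max (R : realType) (A B C : R * R) :
  orient A B C != 0 ->
  ~ local_maxima (phi A B C) (triangle_boundary A B C) A /\
  ~ local_maxima (phi A B C) (triangle_boundary A B C) B.
Proof.
move=> o.
have phi0 : phi A B C A = 0 /\ phi A B C B = 0.
  by rewrite /phi !distpp !(mul0r, mulr0).
have onb (t : R) : 0 < t < 1 -> triangle_boundary A B C (point_on A B t).
  by move=> t01; left; left; exists t; split=> //; lra.
split.
- rewrite -[X in local_maxima _ _ X](point_on0 _ A B).
  apply: (@not_local_max_path _ _ _ _ _ 0 1) => //.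
    exact: point_on_continuous.
  move=> s s01; rewrite point_on0 phi0.1 phi_gt0_on_side //.
  by split=> //; exact: onb.
- rewrite -[X in local_maxima _ _ X](point_on0 _ B A).
  apply: (@not_local_max_path _ _ _ _ _ 0 1) => //.
    exact: point_on_continuous.
  move=> s s01; rewrite point_on0 phi0.2 point_onC phi_gt0_on_side //; last lra.
  by split=> //; apply: onb; lra.
Qed.

Lemma boundary_cases (R : realType) (A B C p : R * R) :
  triangle_boundary A B C p ->
  [set A; B; C] p \/
  (side_interior A B `|` side_interior B C `|` side_interior A C) p.
Proof.
have cases (P Q : R * R) : side P Q p -> p = P \/ p = Q \/ side_interior P Q p.
  move=> pPQ; have [->|nP] := pselect (p = P); first by left.
  have [->|nQ] := pselect (p = Q); first by right; left.
  by right; right; split=> // -[].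
case=> [[] /cases|/cases] [->|[->|pI]];
  try by [left; left; left | left; left; right | left; right].
- by right; left; left.
- by right; left; right.
- by right; right.
Qed.

(** The vertices are zeros of the nonnegative function phi, which is positive on
    the open sides: they are minima and not maxima. *)
Lemma boundary_extrema (R : realType) (A B C : R * R) :
  orient A B C != 0 ->
  let M := local_maxima (phi A B C) (triangle_boundary A B C) in
  let m := local_minima (phi A B C) (triangle_boundary A B C) in
  M = (M `&` side_interior A B) `|` (M `&` side_interior B C)
        `|` (M `&` side_interior A C) /\
  m = [set A; B; C] `|` ((m `&` side_interior A B) `|`
        (m `&` side_interior B C) `|` (m `&` side_interior A C)).
Proof.
move=> o M m; have [nA nB] := endpoints_not_max _ _ _ _ o.
have oC : orient C B A != 0.
  have -> : orient C B A = - orient A B C by rewrite /orient; ring.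
  by rewrite oppr_eq0.
have [nC _] := endpoints_not_max _ _ _ _ oC.
rewrite phi_rev triangle_boundary_rev in nC.
split; rewrite -!setIUr; apply/seteqP; split=> p.
- move=> pM; split=> //.
  have [|//] := boundary_cases _ _ _ _ _ (proj1 pM).
  by case=> [[]|] /= e; move: pM; rewrite e.
- by case.
- by move=> pm; case: (boundary_cases _ _ _ _ _ (proj1 pm)) => ?; [left|right].
- case=> [pV|[]//]; split.
  + by case: pV => [[]|] ->; [left; left; exact: side_left |
      left; left; exact: side_right | right; exact: side_right].
  + have -> : phi A B C p = 0.
      by case: pV => [[]|] ->; rewrite /phi distpp !(mul0r, mulr0).
    by rewrite near_withinE; near=> q => _; exact: phi_ge0.
Unshelve. all: by end_near. Qed.

Lemma dist_to_set_min (R : realType) (p q : R * R) (X : set (R * R)) :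
  X q -> (forall x, X x -> dist p q <= dist p x) -> dist_to_set p X = dist p q.
Proof.
move=> Xq qmin; have lb : lbound [set dist p x | x in X] (dist p q).
  by move=> _ [x Xx <-]; exact: qmin.
apply/eqP; rewrite eq_le; apply/andP; split.
- by apply: ge_inf; [exists (dist p q) | exists q].
- by apply: lb_le_inf => //; exists (dist p q), q.
Qed.

(** The nearest point of the base line to the apex is the midpoint of the base. *)
Lemma dist_to_base_sqr (R : realType) (A B C : R * R) (k : R) :
  dist A B ^+ 2 = k -> dist B C ^+ 2 = k -> dist A C ^+ 2 = 1 ->
  dist_to_set B (line A C) ^+ 2 = k - 4^-1.
Proof.
move=> dAB dBC dAC.
have dE t : dist B (point_on A C t) ^+ 2 = k - t * (1 - t).
  by rewrite distC stewart (distC _ C B) dAB dBC dAC; ring.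
rewrite (@dist_to_set_min _ _ (point_on A C 2^-1)).
- by rewrite dE; field.
- by exists 2^-1.
- move=> _ [t ->]; rewrite -(ler_pXn2r (n := 2)) ?nnegrE ?dist_ge0 // dE.
  have -> : dist B ((1 - t) * A.1 + t * C.1, (1 - t) * A.2 + t * C.2) ^+ 2
    = k - t * (1 - t) by exact: dE.
  rewrite -subr_ge0; have -> : k - t * (1 - t) - (k - 2^-1 * (1 - 2^-1))
    = (t - 2^-1) ^+ 2 by field.
  exact: sqr_ge0.
Qed.

Lemma card_setU1 (T : Type) (X : set T) (x : T) (n : nat) :
  ~ X x -> X #= `I_n -> X `|` [set x] #= `I_n.+1.
Proof.
move=> nXx cX; apply/eq_cardSP; exists x; first by right.
by rewrite setDUl setDv setU0 not_setD1.
Qed.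

Lemma side_interiors_neq (R : realType) (A B C p q : R * R) :
  orient A B C != 0 -> side_interior A B p ->
  side A C q \/ side B C q -> p <> q.
Proof.
move=> o; rewrite side_interiorE ?(orient_neq _ _ _ _ o) // => -[t].
rewrite /= in_itv /= => /(side_interior_disjoint _ _ _ _ _ o)[nAC nBC] <-.
by case=> + e; rewrite -e.
Qed.

Theorem mainTheorem2 (R : realType) (A B C : R * R) (b : R)
  (nondegenerate : ~ collinear A B C)
  (isosceles : dist A B = dist B C)
  (scaled : dist A C = 1)
  (b_def : b = dist_to_set B (line A C))
  (b_gt0 : 0 < b) :
  let maxima := local_maxima (phi A B C) (triangle_boundary A B C) in
  let minima := local_minima (phi A B C) (triangle_boundary A B C) in
  ((Num.sqrt 8)^-1 <= b ->
     (maxima #= `I_3 /\ minima #= `I_3) /\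
     minima = [set A; B; C] /\
     [/\ maxima `&` side_interior A B #= `I_1,
         maxima `&` side_interior B C #= `I_1 &
         maxima `&` side_interior A C #= `I_1]) /\
  (b < (Num.sqrt 8)^-1 ->
     (maxima #= `I_4 /\ minima #= `I_4) /\
     (exists2 m, side_interior A C m & minima = [set A; B; C; m]) /\
     [/\ maxima `&` side_interior A C #= `I_2,
         maxima `&` side_interior A B #= `I_1 &
         maxima `&` side_interior B C #= `I_1]).
Proof.
move=> maxima minima; pose k := dist A B ^+ 2.
have dAB : dist A B ^+ 2 = k by [].
have dBC : dist B C ^+ 2 = k by rewrite -isosceles.
have dAC : dist A C ^+ 2 = 1 by rewrite scaled expr1n.
have b2 : b ^+ 2 = k - 4^-1.
  by rewrite b_def (dist_to_base_sqr _ _ _ _ _ dAB dBC dAC).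
have b2_gt0 : 0 < b ^+ 2 by rewrite exprn_gt0.
have k_gt0 : 0 < k by lra.
have o : orient A B C != 0.
  rewrite -sqrf_eq0 orient_sqr dAB dBC dAC.
  have -> : k * 1 - ((k + 1 - k) / 2) ^+ 2 = b ^+ 2 by rewrite b2; field.
  by rewrite lt0r_neq0.
have oC : orient C B A != 0.
  have -> : orient C B A = - orient A B C by rewrite /orient; ring.
  by rewrite oppr_eq0.
have oS : orient A C B != 0.
  have -> : orient A C B = - orient A B C by rewrite /orient; ring.
  by rewrite oppr_eq0.
have [maxE minE] := boundary_extrema _ _ _ _ o.
rewrite -/maxima -/minima in maxE minE.
have [s [s01 sAB nAB]] := leg_extrema _ _ _ _ _ dAB dBC dAC k_gt0.
have [u [u01 uCB nCB]] : exists s, [/\ 0 < s < 1,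
    local_maxima (phi C B A \o point_on C B) `]0, 1[ = [set s] &
    local_minima (phi C B A \o point_on C B) `]0, 1[ = set0].
  by apply: (leg_extrema _ _ _ _ k); rewrite // distC.
pose p := point_on A B s; pose q := point_on C B u.
have maxAB : maxima `&` side_interior A B = [set p].
  by rewrite local_maxima_on_side // sAB image_set1.
have maxBC : maxima `&` side_interior B C = [set q].
  rewrite side_interiorC /maxima -triangle_boundary_rev -phi_rev.
  by rewrite local_maxima_on_side // uCB image_set1.
have minAB : minima `&` side_interior A B = set0.
  by rewrite local_minima_on_side // nAB image_set0.
have minBC : minima `&` side_interior B C = set0.
  rewrite side_interiorC /minima -triangle_boundary_rev -phi_rev.
  by rewrite local_minima_on_side // nCB image_set0.
have maxAC : maxima `&` side_interior A C =
    point_on A C @` local_maxima (phi A B C \o point_on A C) `]0, 1[.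
  by rewrite /maxima -triangle_boundary_swap local_maxima_on_side.
have minAC : minima `&` side_interior A C =
    point_on A C @` local_minima (phi A B C \o point_on A C) `]0, 1[.
  by rewrite /minima -triangle_boundary_swap local_minima_on_side.
have neqAC := orient_neq _ _ _ _ oS.
have pI : side_interior A B p.
  rewrite side_interiorE ?(orient_neq _ _ _ _ o) //.
  by exists s; rewrite //= in_itv.
have qI : side_interior C B q.
  rewrite side_interiorE ?(orient_neq _ _ _ _ oC) //.
  by exists u; rewrite //= in_itv.
have onAC (t : R) : 0 < t < 1 -> side_interior A C (point_on A C t).
  by move=> t01; rewrite side_interiorE //; exists t; rewrite //= in_itv.
have pq : p <> q.
  apply: (side_interiors_neq _ _ _ _ _ _ o pI).
  by right; rewrite sideC; case: qI.
have pAC r : side_interior A C r -> p <> r.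
  by case=> rI _; apply: (side_interiors_neq _ _ _ _ _ _ o pI); left.
have qAC r : side_interior A C r -> q <> r.
  case=> rI _; apply: (side_interiors_neq _ _ _ _ _ _ oC qI).
  by left; rewrite sideC.
have neqV r : side_interior A C r -> r <> B.
  move=> rI; apply: (side_interiors_neq _ _ _ _ _ _ oS rI).
  by left; exact: side_right.
have cardV : [set A; B; C] #= `I_3.
  apply: card_setU1; last apply: card_setU1; last exact: card_set1.
  - by case=> /eqP; rewrite eq_sym; apply/negP;
      [|rewrite eq_sym; exact: orient_neq oC].
  - by apply/eqP; rewrite eq_sym; exact: orient_neq o.
(* The threshold b^2 = 1/8, that is k = 3/8. *)
have inv8 : (Num.sqrt 8)^-1 ^+ 2 = 8^-1 :> R by rewrite exprVn sqr_sqrtr.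
have inv8_ge0 : 0 <= (Num.sqrt 8)^-1 :> R by rewrite invr_ge0 sqrtr_ge0.
split.
- rewrite -(ler_pXn2r (n := 2)) ?nnegrE ?(ltW b_gt0) // inv8 b2 => k38.
  have [|mAC nAC] := base_extrema_high _ _ _ _ _ dAB dBC dAC; first lra.
  rewrite mAC image_set1 in maxAC; rewrite nAC image_set0 in minAC.
  have hI : side_interior A C (point_on A C 2^-1) by apply: onAC; lra.
  rewrite maxAB maxBC maxAC in maxE.
  rewrite minAB minBC minAC !setU0 in minE.
  rewrite maxAB maxBC maxAC maxE minE; split; last first.
    by split=> //; split; exact: card_set1.
  split=> //.
  apply: card_setU1; last apply: card_setU1; last exact: card_set1.
  + by case=> /esym; [exact: pAC | exact: qAC].
  + by move=> /esym.
- rewrite -(ltr_pXn2r (n := 2)) ?nnegrE ?(ltW b_gt0) // inv8 b2 => k38.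
  have [|r [r01 mAC nAC]] := base_extrema_low _ _ _ _ _ dAB dBC dAC; first lra.
  rewrite mAC image_setU !image_set1 in maxAC; rewrite nAC image_set1 in minAC.
  set h := point_on A C 2^-1 in minAC.
  set h1 := point_on A C (2^-1 - r) in maxAC.
  set h2 := point_on A C (2^-1 + r) in maxAC.
  have hI : side_interior A C h by apply: onAC; lra.
  have h1I : side_interior A C h1 by apply: onAC; lra.
  have h2I : side_interior A C h2 by apply: onAC; lra.
  have h21 : h2 <> h1 by move=> /(point_on_inj _ _ _ neqAC); lra.
  rewrite maxAB maxBC maxAC setUA in maxE.
  rewrite minAB minBC minAC !set0U in minE.
  rewrite maxAB maxBC maxAC maxE minE; split; last first.
    split; first by exists h.
    split; try exact: card_set1.
    by apply: card_setU1 => //; exact: card_set1.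
  split; apply: card_setU1 => //.
  + by case=> [[]|] => [/esym|/esym|]; [exact: pAC | exact: qAC | exact: h21].
  + apply: card_setU1; last apply: card_setU1; last exact: card_set1.
    * by case=> /esym; [exact: pAC | exact: qAC].
    * by move=> /esym.
  + by case=> [[]|]; [| exact: neqV |] => e; case: hI => _; apply; [left|right].
Qed.
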